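(* Let $(X,d)$ be a complete metric space. If a parameterized iterated function system $\mathcal{F}=\{X; f_\lambda\mid\lambda\in\Lambda\}$ on $X$ is uniformly contracting, then it has the weak shadowing property on $\mathbb{Z}_+$.
   Context: A parameterized iterated function system (IFS) $\mathcal{F}=\{X; f_\lambda\mid\lambda\in\Lambda\}$ on a metric space $(X,d)$ is a family of continuous maps $f_\lambda:X\to X$, $\lambda\in\Lambda$, where $\Lambda$ is a finite nonempty set. Let $\mathbb{Z}_+=\{n\in\mathbb{Z}: n\ge 0\}$. $\mathcal{F}$ is uniformly contracting if $$\beta=\sup_{\lambda\in\Lambda}\sup_{x\neq y}\frac{d(f_\lambda(x),f_\lambda(y))}{d(x,y)}$$ exists and is less than one. A sequence $\{x_n\}_{n\in\mathbb{Z}_+}$ in $X$ is an orbit of $\mathcal{F}$ if there exists $\{\lambda_n\}_{n\in\mathbb{Z}_+}\in\Lambda^{\mathbb{Z}_+}$ such that $x_{n+1}=f_{\lambda_n}(x_n)$ for all $n\in\mathbb{Z}_+$. Given $\delta>0$, a sequence $\{x_n\}_{n\in\mathbb{Z}_+}$ in $X$ is a $\delta$-pseudo orbit of $\mathcal{F}$ if there exists $\{\lambda_n\}_{n\in\mathbb{Z}_+}\in\Lambda^{\mathbb{Z}_+}$ such that $d(x_{n+1},f_{\lambda_n}(x_n))<\delta$ for all $n\in\mathbb{Z}_+$. For $S\subset X$ and $\epsilon>0$, $B_\epsilon(S)$ denotes the set of all $x\in X$ such that $d(x,S)<\epsilon$. $\mathcal{F}$ has the weak shadowing property on $\mathbb{Z}_+$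 if for every $\epsilon>0$ there exists $\delta>0$ such that for every $\delta$-pseudo orbit $\mathbf{x}=\{x_n\}_{n\in\mathbb{Z}_+}$ of $\mathcal{F}$ there is an orbit $\mathbf{y}=\{y_n\}_{n\in\mathbb{Z}_+}$ of $\mathcal{F}$ with $\mathbf{y}\subset B_\epsilon(\mathbf{x})$ (sequences being identified with their sets of terms). *)

(* Defs.v *)
From HB Require Import structures.
From mathcomp Require Import all_boot all_order all_algebra.
From mathcomp Require Import boolp classical_sets functions reals ereal.
From mathcomp Require Import topology metric_structure.

Set Implicit Arguments.
Unset Strict Implicit.
Unset Printing Implicit Defensive.

Import Order.TTheory GRing.Theory Num.Theory.
Local Open Scope classical_set_scope.
Local Open Scope ring_scope.

(* The library's [completeType] and [cvg] need a pointed type; stated this way,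
   completeness does not exclude the empty metric space. *)
Definition complete_metric (R : realType) (X : metricType R) : Prop :=
  forall u : nat -> X, cauchy (u @ \oo) -> exists a : X, u @ \oo --> a.

Record param_ifs (R : realType) (X : metricType R) (L : finType) := ParamIFS {
  ifs_fun :> L -> X -> X;
  ifs_continuous : forall l : L, continuous (ifs_fun l);
  ifs_index_nonempty : (0 < #|L|)%N }.

Section ParamIFS.
Variables (R : realType) (X : metricType R) (L : finType).
Implicit Types (F : param_ifs X L) (x y : nat -> X) (S : set X).

(* The suprema are taken in the extended reals: an unbounded family of ratios
   gives +oo, and -oo occurs only when X has at most one point. *)
Definition contraction_ratio F : \bar R :=
  ereal_sup [set ereal_sup
      [set (mdist (F l p.1) (F l p.2) / mdist p.1 p.2)%:E
        | p in [set p : X * X | p.1 <> p.2]]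
    | l in [set: L]].

Definition uniformly_contracting F : Prop := (contraction_ratio F < 1)%E.

Definition is_orbit F x : Prop :=
  exists l : nat -> L, forall n, x n.+1 = F (l n) (x n).

Definition is_pseudo_orbit F (delta : R) x : Prop :=
  exists l : nat -> L, forall n, mdist (x n.+1) (F (l n) (x n)) < delta.

(* The infimum over the empty set is +oo. *)
Definition dist_to_set (z : X) S : \bar R :=
  ereal_inf [set (mdist z s)%:E | s in S].

Definition set_ball (eps : R) S : set X :=
  [set z | (dist_to_set z S < eps%:E)%E].

Definition weak_shadowing F : Prop :=
  forall eps : R, 0 < eps ->
  exists2 delta : R, 0 < delta &
  forall x, is_pseudo_orbit F delta x ->
  exists2 y, is_orbit F y & range y `<=` set_ball eps (range x).

End ParamIFS.

(* Main.v *)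
Require Import Defs.
From mathcomp Require Import all_boot all_order all_algebra.
From mathcomp Require Import reals metric_structure.
From mathcomp Require Import boolp classical_sets ereal.
From mathcomp Require Import lra.

(** The orbit that starts at the first point of a pseudo orbit [x] and applies
    the same sequence of indices stays close to [x], term by term.  If every
    map contracts distances by a factor [k < 1] and [e n] is the distance
    between the [n]-th terms, the triangle inequality through the image of
    [x n] gives [e n.+1 < delta + k * e n].  The choice
    [delta = (1 - k) * eps] makes [eps] the fixed point of the affine map on
    the right, so [e n < eps] propagates from [e 0 = 0].  The two sequences are
    thus close at every index, which is stronger than weak shadowing: there,
    each term of the orbit need only be close to some term of [x]. *)

Import Order.TTheory GRing.Theory Num.Theory.
Local Open Scope classical_set_scope.
Local Open Scope ring_scope.

(** The contraction ratio is an extended real, -oo when there are no two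
    distinct points, whereas the error estimate needs a nonnegative real factor
    valid for all pairs, equal points included. *)
Lemma uniformly_contracting_lipschitz (R : realType) (X : metricType R)
    (L : finType) (F : param_ifs X L) :
  uniformly_contracting F ->
  exists k : R, [/\ 0 <= k, k < 1 &
    forall l a b, mdist (F l a) (F l b) <= k * mdist a b].
Proof.
move=> ratio_lt1.
have [k [k_ge0 k_lt1 ratio_le]] :
    exists k : R, [/\ 0 <= k, k < 1 & (contraction_ratio F <= k%:E)%E].
  move: ratio_lt1; rewrite /uniformly_contracting.
  case: (contraction_ratio F) => [r| |] //.
  - rewrite lte_fin => r_lt1; exists (Num.max 0 r).
    by rewrite le_max lexx gt_max ltr01 r_lt1 lee_fin le_max lexx orbT.
  - by move=> _; exists 0; rewrite lexx ltr01 leNye.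
exists k; split=> // l a b.
have [->|a_neq_b] := pselect (a = b); first by rewrite !mdistxx mulr0.
have dist_gt0 : 0 < mdist a b by rewrite mdist_gt0; apply/eqP.
rewrite -ler_pdivrMr // -lee_fin; apply: le_trans ratio_le.
apply: (@le_trans _ _ (ereal_sup
    [set (mdist (F l p.1) (F l p.2) / mdist p.1 p.2)%:E
      | p in [set p : X * X | p.1 <> p.2]])).
  by apply: ereal_sup_ubound; exists (a, b).
by apply: ereal_sup_ubound; exists l.
Qed.

Fixpoint orbit_from {R : realType} {X : metricType R} {L : finType}
    (F : param_ifs X L) (l : nat -> L) (a : X) (n : nat) : X :=
  if n is m.+1 then F (l m) (orbit_from F l a m) else a.

(** The index sequence is kept explicit because the shadowing orbit must reuse
    the indices of the pseudo orbit: two points pushed by different maps need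
    not come closer. *)
Lemma pseudo_orbit_shadowing (R : realType) (X : metricType R) (L : finType)
    (F : param_ifs X L) (k eps : R) (l : nat -> L) (x : nat -> X) :
  0 <= k -> (forall i a b, mdist (F i a) (F i b) <= k * mdist a b) ->
  0 < eps ->
  (forall n, mdist (x n.+1) (F (l n) (x n)) < (1 - k) * eps) ->
  forall n, mdist (orbit_from F l (x 0%N) n) (x n) < eps.
Proof.
move=> k_ge0 F_lip eps_gt0 x_pseudo; elim=> [|n IHn] /=.
  by rewrite mdistxx.
have step := x_pseudo n; rewrite metric_sym in step.
have contr := F_lip (l n) (orbit_from F l (x 0%N) n) (x n).
have tri := metric_triangle (F (l n) (orbit_from F l (x 0%N) n))
  (F (l n) (x n)) (x n.+1).
have := ler_wpM2l k_ge0 (ltW IHn).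
lra.
Qed.

Lemma set_ball_near (R : realType) (X : metricType R) (eps : R) (S : set X)
    (z s : X) : S s -> mdist z s < eps -> set_ball eps S z.
Proof.
move=> Ss z_near_s; rewrite /set_ball /=.
apply: (@le_lt_trans _ _ (mdist z s)%:E); last by rewrite lte_fin.
by apply: ereal_inf_lbound; exists s.
Qed.

Theorem corollary3p3 (R : realType) (X : metricType R) (L : finType)
    (F : param_ifs X L) :
  complete_metric X -> uniformly_contracting F -> weak_shadowing F.
Proof.
move=> _ /uniformly_contracting_lipschitz [k [k_ge0 k_lt1 F_lip]] eps eps_gt0.
exists ((1 - k) * eps); first by rewrite mulr_gt0 // subr_gt0.
move=> x [l x_pseudo]; exists (orbit_from F l (x 0%N)); first by exists l.
move=> _ [n _ <-]; apply: (@set_ball_near _ _ _ _ _ (x n)); first by exists n.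
exact: (@pseudo_orbit_shadowing _ _ _ F k).
Qed.
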